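(* There exists some $\upsilon>0$ such that for any $t\geq\upsilon$ and any $Q_1,Q_2\in\mathbb{S}^+_{r_1}$ we have $$\Vert\phi_t(Q_1)-\phi_t(Q_2)\Vert_2\leq\alpha\exp\{-\beta t\}\,\Vert Q_1-Q_2\Vert_2$$ for some positive parameters $(\alpha,\beta)$ whose values only depend on $(\Lambda_{\min},\Lambda_{\max})$. The same inequality holds for any time $t\geq0$ for some $\alpha=\alpha(Q_1,Q_2)$ that also depends on $(Q_1,Q_2)$.
   Context: Let $r_1,r_2\ge 1$. $\mathbb{S}^+_{r}$ is the set of real symmetric positive definite $(r\times r)$-matrices, $'$ denotes transpose, $Id$ the identity, $\leq$ between symmetric matrices is the Loewner order, and $\Vert\cdot\Vert_2$ is the spectral norm. Model (fixed throughout): $t\in[0,\infty)\mapsto A_t\in\mathbb{R}^{r_1\times r_1}$ and $t\mapsto C_t\in\mathbb{R}^{r_2\times r_1}$ are smooth matrix flows, bounded uniformly in time; $R_1\in\mathbb{S}^+_{r_1}$ and $R_2\in\mathbb{S}^+_{r_2}$ are constant positive definite matrices. Set $S_t:=C_t'R_2^{-1}C_t$. Riccati flow: for $Q\in\mathbb{S}^+_{r_1}$ and $0\le s\le t$, $\phi_{s,t}(Q)$ denotes the solution of $$\partial_t\phi_{s,t}(Q)=A_t\phi_{s,t}(Q)+\phi_{s,t}(Q)A_t'-\phi_{s,t}(Q)S_t\phi_{s,t}(Q)+R_1,\qquad \phi_{s,s}(Q)=Q,$$ and $\phi_t(Q):=\phi_{0,t}(Q)$. Uniform observability/controllability (standing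 assumption): let $\mathcal{E}_{s,t}(A)$, $s\le t$, be the transition matrix given by $\partial_t\mathcal{E}_{s,t}(A)=A_t\mathcal{E}_{s,t}(A)$, $\mathcal{E}_{s,s}(A)=Id$, and set $$\mathcal{C}_{s,t}:=\int_s^t\mathcal{E}_{r,t}(A)R_1\mathcal{E}_{r,t}(A)'\,dr,\qquad \mathcal{O}_{s,t}:=\int_s^t\big(\mathcal{E}_{r,t}(A)^{-1}\big)'S_r\,\mathcal{E}_{r,t}(A)^{-1}\,dr.$$ It is assumed that there are parameters $\upsilon_0,\varpi^{c}_{\pm},\varpi^{o}_{\pm}>0$ such that, uniformly for all $t\ge0$, $$\varpi^c_-Id\le\mathcal{C}_{t,t+\upsilon_0}\le\varpi^c_+Id,\qquad \varpi^o_-Id\le\mathcal{O}_{t,t+\upsilon_0}\le\varpi^o_+Id.$$ Under this assumption there are $\upsilon>0$ and $\Lambda_{\min},\Lambda_{\max}\in\mathbb{S}^+_{r_1}$ such that $\Lambda_{\min}\le\phi_t(Q)\le\Lambda_{\max}$ for all $t\ge\upsilon$ and all $Q\in\mathbb{S}^+_{r_1}$; these are the matrices $\Lambda_{\min},\Lambda_{\max}$ of the claim. Since the model is fixed, ''only depend on $(\Lambda_{\min},\Lambda_{\max})$'' means in particular that $\alpha,\beta$ do not depend on $t,Q_1,Q_2$. *)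

(* Defs.v *)
From HB Require Import structures.
From mathcomp Require Import all_boot all_order all_algebra.
From mathcomp Require Import all_classical all_reals all_analysis.

Set Implicit Arguments.
Unset Strict Implicit.
Unset Printing Implicit Defensive.

Import Order.TTheory GRing.Theory Num.Theory.
Import numFieldNormedType.Exports.

Local Open Scope classical_set_scope.
Local Open Scope ring_scope.

Section Matrices.
Variable R : realType.

Definition spd (r : nat) (M : 'M[R]_r) : Prop :=
  M^T = M /\ forall x : 'cV[R]_r, x != 0 -> 0 < (x^T *m M *m x) 0 0.

Definition psd (r : nat) (M : 'M[R]_r) : Prop :=
  M^T = M /\ forall x : 'cV[R]_r, 0 <= (x^T *m M *m x) 0 0.

Definition loewner_le (r : nat) (M N : 'M[R]_r) : Prop := psd (N - M).

(* The library norm [`|x|] of a matrix is the maximum of the absolute values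
   of its entries, hence the separate Euclidean and spectral norms. *)
Definition enorm (n : nat) (x : 'cV[R]_n) : R :=
  Num.sqrt (\sum_(i < n) x i 0 ^+ 2).

Definition specnorm (m n : nat) (M : 'M[R]_(m, n)) : R :=
  sup [set enorm (M *m x) | x in [set x : 'cV[R]_n | enorm x <= 1]].

Definition mxintegral (m n : nat) (s t : R) (F : R -> 'M[R]_(m, n)) :
    'M[R]_(m, n) :=
  \matrix_(i, j) Rintegral (@lebesgue_measure R) `[s, t] (fun u => F u i j).

End Matrices.

Section Flows.
Variable R : realType.

(* [l] is the derivative of [f] at [t] along the domain [D]: two-sided in the
   interior of an interval, one-sided at an end point that belongs to it.
   The values of [f] outside of [D] are irrelevant. *)
Definition is_derive_within (V : normedModType R) (D : set R) (f : R -> V)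
    (t : R) (l : V) : Prop :=
  h^-1 *: (f (t + h) - f t) @[h --> within [set h | D (t + h)] 0^'] --> l.

(* [d n] is the [n]-th derivative of [f] on [0, +oo[. *)
Definition smooth_flow (V : normedModType R) (f : R -> V) : Prop :=
  exists d : nat -> R -> V,
    d 0%N = f /\
    forall (n : nat) (t : R), 0 <= t ->
      is_derive_within `[0, +oo[ (d n) t (d n.+1 t).

Definition Sflow (r1 r2 : nat) (C : R -> 'M[R]_(r2, r1)) (R2 : 'M[R]_r2)
    (t : R) : 'M[R]_r1 :=
  (C t)^T *m invmx R2 *m C t.

Definition riccati_flow (r : nat) (A S : R -> 'M[R]_r) (R1 : 'M[R]_r)
    (phi : R -> R -> 'M[R]_r -> 'M[R]_r) : Prop :=
  forall (s : R) (Q : 'M[R]_r), 0 <= s -> spd Q ->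
    phi s s Q = Q /\
    forall t : R, s <= t ->
      is_derive_within `[s, +oo[ (fun u => phi s u Q) t
        (A t *m phi s t Q + phi s t Q *m (A t)^T
         - phi s t Q *m S t *m phi s t Q + R1).

Definition transition_flow (r : nat) (A : R -> 'M[R]_r)
    (E : R -> R -> 'M[R]_r) : Prop :=
  forall s : R, 0 <= s ->
    E s s = 1%:M /\
    forall t : R, s <= t ->
      is_derive_within `[s, +oo[ (fun u => E s u) t (A t *m E s t).

Definition ctrl_gramian (r : nat) (E : R -> R -> 'M[R]_r) (R1 : 'M[R]_r)
    (s t : R) : 'M[R]_r :=
  mxintegral s t (fun u => E u t *m R1 *m (E u t)^T).

Definition obs_gramian (r : nat) (E : R -> R -> 'M[R]_r) (S : R -> 'M[R]_r)
    (s t : R) : 'M[R]_r :=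
  mxintegral s t (fun u => (invmx (E u t))^T *m S u *m invmx (E u t)).

(* [wcm], [wcp], [wom], [wop] are the lower and upper bounds of the
   controllability and of the observability Gramians. *)
Definition uniform_obs_ctrl (r : nat) (E : R -> R -> 'M[R]_r)
    (S : R -> 'M[R]_r) (R1 : 'M[R]_r) : Prop :=
  exists v0 wcm wcp wom wop : R,
    [/\ 0 < v0, 0 < wcm, 0 < wcp, 0 < wom & 0 < wop] /\
    forall t : R, 0 <= t ->
      [/\ loewner_le wcm%:M (ctrl_gramian E R1 t (t + v0)),
          loewner_le (ctrl_gramian E R1 t (t + v0)) wcp%:M,
          loewner_le wom%:M (obs_gramian E S t (t + v0))
        & loewner_le (obs_gramian E S t (t + v0)) wop%:M].

Definition riccati_bounds (r : nat) (phi : R -> R -> 'M[R]_r -> 'M[R]_r)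
    (Lmin Lmax : 'M[R]_r) : Prop :=
  [/\ spd Lmin, spd Lmax &
      exists v : R, 0 < v /\
        forall (t : R) (Q : 'M[R]_r), v <= t -> spd Q ->
          loewner_le Lmin (phi 0 t Q) /\ loewner_le (phi 0 t Q) Lmax].

End Flows.

(* Main.v *)
Require Import Defs.
From HB Require Import structures.
From mathcomp Require Import all_boot all_order all_algebra.
From mathcomp Require Import all_classical all_reals all_analysis.
From mathcomp Require Import perm ring lra.

Set Implicit Arguments.
Unset Strict Implicit.
Unset Printing Implicit Defensive.

Import Order.TTheory GRing.Theory Num.Theory.
Import numFieldNormedType.Exports.

Local Open Scope classical_set_scope.
Local Open Scope ring_scope.

(** Write [D_ij = phi_i - phi_j] for the difference of two solutions, with
    [F_i = A - phi_i S] and [H_j = A^T - S phi_j].  Subtracting two Riccati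
    equations gives the bilinear identity [D_ij' = F_i D_ij + D_ij H_j], and
    everything is read off from it.  The matrices [Lmin] and [Lmax] enter
    through [Lmin <= phi_t(Q) <= Lmax] for [t >= v] and every [Q].

    Decay after time [v].  Let [X] and [Y] be the inverses of [phi_1] and
    [phi_2].  In [V = tr (X D Y D)] with [D = D_12] the terms that contain the
    drifts cancel, and what is left is
    [V' = - tr ((S + X R1 X) D Y D) - tr (X D (S + Y R1 Y) D)].  Since
    [phi_i <= Lmax], the matrix [R1] dominates a positive multiple of [phi_i],
    so [X R1 X] dominates that multiple of [X], and [V] decays exponentially.
    The two-sided bound on the solutions makes [V] comparable with the square
    of the norm of [D] ([riccati_decay]).

    Lipschitz constant at time [v], uniform in [Q_1] and [Q_2].  This is the
    delicate half, because [phi_t(Q)] is not controlled uniformly in [Q] on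
    [0, v].  The Riccati flow acts by linear fractional maps, so it becomes
    affine in the chart [phi |-> (phi_a - phi)^-1] around a solution [phi_a].
    Take [phi_a] started from [l Id] with [l] large compared with [Q_1] and
    [Q_2], a substitute for the solution started at infinity, and let [phi_b]
    be the solution started from [Id].  Then
    [N = D_ab ((D_a1)^-1 - (D_a2)^-1) D_ab] solves [N' = F_b N + N H_b], whose
    coefficients depend on [phi_b] only, and its norm at time 0 is at most a
    constant times that of [Q_1 - Q_2]; hence so is its norm at time [v]
    ([conj_chart_bound]).  One recovers
    [D_12 = D_a1 (D_ab)^-1 N (D_ab)^-1 D_a2]; here [D_a1] and [D_a2] are
    bounded at time [v] by [Lmax], and the inverse of [D_ab] solves an affine
    equation driven by [phi_b] with an initial value at most [Id], so it is
    bounded uniformly in [l] ([chart_bound]).  This yields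
    [riccati_flow_lipschitz].

    The estimate up to time 0 then only has to cover [0, v], where the
    difference is bounded and the constant may depend on [Q_1] and [Q_2]. *)

(** * Differential calculus of matrix-valued functions *)

Section MatrixCalculus.
Variable R : realType.

Lemma mx_is_deriveP m n (M : R -> 'M[R]_(m, n)) (t : R) L :
  is_derive t (1 : R) M L <->
  forall i j, is_derive t (1 : R) (fun u => M u i j) (L i j).
Proof.
split=> [[dM <-] i j|dM].
  split; first exact: (derivable_mxP M t 1).1.
  by rewrite derive_mx // mxE.
have dM' : derivable M t 1.
  by apply/derivable_mxP => i j; have [] := dM i j.
split=> //; rewrite derive_mx //; apply/matrixP => i j; rewrite mxE.
by have [] := dM i j.
Qed.

Lemma is_derive_mulmx m n p (M : R -> 'M[R]_(m, n)) (N : R -> 'M[R]_(n, p))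
    (t : R) L K :
  is_derive t (1 : R) M L -> is_derive t (1 : R) N K ->
  is_derive t (1 : R) (fun u => M u *m N u) (L *m N t + M t *m K).
Proof.
move=> /mx_is_deriveP dM /mx_is_deriveP dN; apply/mx_is_deriveP => i k.
rewrite (_ : (fun u => _) =
    \sum_(j < n) ((fun u => M u i j) * (fun u => N u j k))); last first.
  by apply/funext => u; rewrite mxE fct_sumE.
apply: (is_derive_eq (is_derive_sum (fun j => is_deriveM (dM i j) (dN j k)))).
rewrite !mxE -big_split; apply: eq_bigr => j _ /=.
by rewrite addrC; congr (_ + _); exact: mulrC.
Qed.

Lemma is_derive_trmx m n (M : R -> 'M[R]_(m, n)) (t : R) L :
  is_derive t (1 : R) M L -> is_derive t (1 : R) (fun u => (M u)^T) L^T.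
Proof.
move=> /mx_is_deriveP dM; apply/mx_is_deriveP => i j; rewrite mxE.
by under eq_fun do rewrite mxE.
Qed.

Lemma is_derive_mxtrace n (M : R -> 'M[R]_n) (t : R) L :
  is_derive t (1 : R) M L -> is_derive t (1 : R) (fun u => \tr (M u)) (\tr L).
Proof.
move=> /mx_is_deriveP dM.
rewrite (_ : (fun u => _) = \sum_(i < n) (fun u => M u i i)).
  exact: (is_derive_sum (fun i => dM i i)).
by apply/funext => u; rewrite fct_sumE.
Qed.

(** The Leibniz rule in the shape that the determinant consumes: each summand
    is the full product with one factor replaced, so that over a permutation
    it is again a term of a determinant. *)
Lemma is_derive_prod n (f : 'I_n -> R -> R) (df : 'I_n -> R) (t : R) :
  (forall i, is_derive t (1 : R) (f i) (df i)) ->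
  is_derive t (1 : R) (fun u => \prod_i f i u)
    (\sum_i \prod_j (if j == i then df j else f j t)).
Proof.
elim: n f df => [|n IH] f df dE.
  under eq_fun do rewrite big_ord0.
  by rewrite big_ord0; exact: is_derive_cst.
under eq_fun do rewrite big_ord_recl.
apply: (is_derive_eq (is_deriveM (dE ord0)
  (IH _ _ (fun i => dE (lift ord0 i))))).
rewrite big_ord_recl addrC; congr (_ + _).
  rewrite big_ord_recl eqxx mulrC; congr (_ * _).
rewrite scaler_sumr; apply: eq_bigr => i _; rewrite big_ord_recl /=; congr (_ * _).
Qed.

(** Jacobi's formula.  By multilinearity in the rows, the derivative is the
    sum over [i] of the determinants in which row [i] is differentiated;
    expanding each along that row gives [tr (L adj M)]. *)
Lemma is_derive_det n (M : R -> 'M[R]_n) (t : R) L :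
  is_derive t (1 : R) M L ->
  is_derive t (1 : R) (fun u => \det (M u)) (\tr (L *m \adj (M t))).
Proof.
move=> /mx_is_deriveP dM.
rewrite (_ : (fun u => _) = \sum_(k < #|{perm 'I_n}|)
   ((-1) ^+ (enum_val k : {perm 'I_n}) \*: (fun u => \prod_i M u i (enum_val k i)))); last first.
  apply/funext => u; rewrite fct_sumE /determinant.
  by rewrite (reindex _ (onW_bij _ (@enum_val_bij _))).
have dP (s : {perm 'I_n}) := is_derive_prod (fun i => dM i (s i)).
apply: (is_derive_eq (is_derive_sum (fun k =>
  is_deriveZ ((-1) ^+ (enum_val k : {perm 'I_n})) (dP (enum_val k))))).
pose B i := \matrix_(j, k) if j == i then L j k else M t j k.
transitivity (\sum_i \det (B i)).
  rewrite /determinant exchange_big /=.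
  rewrite (reindex _ (onW_bij _ (@enum_val_bij (perm_type _)))) /=.
  apply: eq_bigr => k _; rewrite scaler_sumr; apply: eq_bigr => i _.
  by congr (_ * _); apply: eq_bigr => j _; rewrite mxE.
apply: eq_bigr => i _; rewrite (expand_det_row _ i) mxE.
apply: eq_bigr => k _; rewrite !mxE eqxx; congr (_ * _).
congr (_ * \det _); apply/matrixP => j l; rewrite !mxE.
by rewrite eq_sym (negbTE (neq_lift _ _)).
Qed.

(** Cramer's rule shows that the inverse is differentiable; the value of the
    derivative then comes from differentiating [M M^-1 = 1]. *)
Lemma is_derive_invmx n (M : R -> 'M[R]_n) (t : R) L :
  M t \in unitmx -> is_derive t (1 : R) M L ->
  is_derive t (1 : R) (fun u => invmx (M u)) (- (invmx (M t) *m L *m invmx (M t))).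
Proof.
move=> Mt dM; have ddet := is_derive_det dM.
have Mu : \forall u \near t, M u \in unitmx.
  near=> u; rewrite unitmxE unitfE; near: u; apply: cvgr_neq0.
    apply/differentiable_continuous/derivable1_diffP; exact: ex_derive.
  by rewrite -unitfE -unitmxE.
have dadj : derivable (fun u => \adj (M u)) t 1.
  apply/derivable_mxP => i j; under eq_fun do rewrite mxE /cofactor.
  apply: derivableM => //.
  suff [] : is_derive t (1 : R) (fun u => \det (row' j (col' i (M u))))
     (\tr (row' j (col' i L) *m \adj (row' j (col' i (M t))))) by [].
  apply: is_derive_det; apply/mx_is_deriveP => k l; rewrite !mxE.
  under eq_fun do rewrite !mxE.
  by move/mx_is_deriveP : dM; exact.
have dG : derivable (fun u => (\det (M u))^-1 *: \adj (M u)) t 1.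
  apply/derivable_mxP => i j; under eq_fun do rewrite mxE.
  apply: derivableM; last exact: (derivable_mxP _ _ _).1.
  by apply: derivableV; [rewrite -unitfE -unitmxE | case: ddet].
have dI : derivable (fun u => invmx (M u)) t 1.
  apply: near_eq_derivable dG; near=> u.
  by rewrite /invmx ifT //; near: u.
split => //.
have /derivableP dI' := dI.
set K := 'D_1 _ t in dI' *.
have d1 := is_derive_mulmx dM dI'.
have : is_derive t (1 : R) (fun u => M u *m invmx (M u)) 0.
  apply: near_eq_is_derive (is_derive_cst 1%:M t 1).
  by near=> u; rewrite mulmxV //; near: u.
move=> [_ d0]; have [_] := d1; rewrite d0 => /esym /eqP.
rewrite addrC addr_eq0 => /eqP e.
by rewrite -[K](mulKmx Mt) e mulmxN mulmxA.
Unshelve. all: by end_near. Qed.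

End MatrixCalculus.

(** * Matrix norms and comparison with exponentials *)

Section Norms.
Variable R : realType.

Lemma mx_norm_ge m n (M : 'M[R]_(m, n)) i j : `|M i j| <= `|M|.
Proof.
rewrite [leRHS]/Num.Def.normr /= mx_normrE.
exact: (le_bigmax _ (fun ij => `|M ij.1 ij.2|) (i, j)).
Qed.

Lemma mx_norm_le m n (M : 'M[R]_(m, n)) c :
  0 <= c -> (forall i j, `|M i j| <= c) -> `|M| <= c.
Proof.
move=> c0 Mc; rewrite [leLHS]/Num.Def.normr /= mx_normrE.
by apply: bigmax_le => // -[i j] _; exact: Mc.
Qed.

Lemma mx_norm_scalar_le n (a : R) : `|a%:M : 'M[R]_n| <= `|a|.
Proof.
by apply: mx_norm_le => // i j; rewrite mxE; case: eqP; rewrite // mulr0n normr0.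
Qed.

Lemma mx_norm_mul m n p (M : 'M[R]_(m, n)) (N : 'M[R]_(n, p)) :
  `|M *m N| <= n%:R * `|M| * `|N|.
Proof.
apply: mx_norm_le => [|i k]; first by rewrite !mulr_ge0.
rewrite mxE (le_trans (ler_norm_sum _ _ _))//.
rewrite -mulrA -[n in n%:R]card_ord mulr_natl -sumr_const.
by apply: ler_sum => j _; rewrite normrM ler_pM // mx_norm_ge.
Qed.

Lemma mx_norm_mul_le m n p (M : 'M[R]_(m, n)) (N : 'M[R]_(n, p)) a b :
  `|M| <= a -> `|N| <= b -> `|M *m N| <= n%:R * a * b.
Proof.
move=> Ma Nb; apply: (le_trans (mx_norm_mul M N)).
by rewrite ler_pM ?mulr_ge0 // ler_wpM2l.
Qed.

Lemma mx_norm_trmx_le m n (M : 'M[R]_(m, n)) : `|M^T| <= `|M|.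
Proof. by apply: mx_norm_le => // i j; rewrite mxE mx_norm_ge. Qed.

Lemma frobeniusE m n (M N : 'M[R]_(m, n)) :
  \tr (M^T *m N) = \sum_j \sum_i M i j * N i j.
Proof.
by apply: eq_bigr => j _; rewrite mxE; apply: eq_bigr => i _; rewrite mxE.
Qed.

Lemma frobenius_le m n (M N : 'M[R]_(m, n)) :
  \tr (M^T *m N) <= (m * n)%:R * `|M| * `|N|.
Proof.
rewrite frobeniusE; apply: (@le_trans _ _ (\sum_(j < n) \sum_(i < m) `|M| * `|N|)).
  apply: ler_sum => j _; apply: ler_sum => i _.
  by rewrite (le_trans (ler_norm _)) // normrM ler_pM // mx_norm_ge.
by rewrite !sumr_const !card_ord -mulrnA -mulrA mulr_natl.
Qed.

(** The maximum norm is not differentiable, so differential inequalities are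
    run on the squared Frobenius norm and transferred back. *)
Lemma mx_norm_frobenius m n (M : 'M[R]_(m, n)) : `|M| ^+ 2 <= \tr (M^T *m M).
Proof.
have F0 : 0 <= \tr (M^T *m M).
  rewrite frobeniusE; apply: sumr_ge0 => j _; apply: sumr_ge0 => i _.
  by rewrite -expr2 sqr_ge0.
rewrite -[leRHS]sqr_sqrtr // lerXn2r ?nnegrE ?sqrtr_ge0 //.
apply: mx_norm_le => [|i j]; first exact: sqrtr_ge0.
rewrite -sqrtr_sqr ler_sqrt // frobeniusE (bigD1 j) //= (bigD1 i) //=.
rewrite -expr2 -addrA lerDl addr_ge0 // sumr_ge0 // => k _.
  by rewrite -expr2 sqr_ge0.
by apply: sumr_ge0 => l _; rewrite -expr2 sqr_ge0.
Qed.

Lemma mx_bounded_segment m n (M L : R -> 'M[R]_(m, n)) (a b : R) :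
  (forall t, a <= t <= b -> is_derive t (1 : R) M (L t)) ->
  exists k, forall t, a <= t <= b -> `|M t| <= k.
Proof.
move=> dM; have [ab|ba] := leP a b; last first.
  by exists 0 => t /andP[a_t /(le_trans a_t)]; rewrite leNgt ba.
have [|c _ maxc] := @EVT_max R (fun t => `|M t|) a b ab.
  apply: continuous_in_subspaceT => t; rewrite inE /= in_itv /= => tab.
  apply: continuous_comp; last exact: norm_continuous.
  apply/differentiable_continuous/derivable1_diffP.
  by have [] := dM t tab.
by exists `|M c| => t tab; apply: maxc; rewrite in_itv.
Qed.

End Norms.

Section Gronwall.
Variable R : realType.

(** [expR (- c * (t - s)) * f t] is nonincreasing.  No sign is imposed on [c],
    so the same lemma serves for growth and for decay. *)
Lemma gronwall (f df : R -> R) (c s T : R) :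
  (forall t, s <= t <= T -> is_derive t (1 : R) f (df t)) ->
  (forall t, s <= t <= T -> df t <= c * f t) ->
  forall t, s <= t <= T -> f t <= expR (c * (t - s)) * f s.
Proof.
move=> Hf Hle t /andP[st tT].
pose g u := expR (- c * (u - s)) * f u.
have dg u : s <= u <= t ->
    is_derive u (1 : R) g (expR (- c * (u - s)) * (df u - c * f u)).
  move=> /andP[su ut].
  have := Hf u; rewrite su (le_trans ut tT) => /(_ isT) dfu.
  apply: is_derive_eq.
  rewrite /GRing.scale /=; ring.
have : g t <= g s.
  apply: (@ler0_derive1_nincr _ g s t) => [u|u||||].
  - by rewrite in_itv /= => /andP[su ut]; have [] := dg u; rewrite ?ltW.
  - rewrite in_itv /= => /andP[su ut]; rewrite derive1E.
    have [|_ ->] := dg u; first by rewrite !ltW.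
    by rewrite pmulr_rle0 ?expR_gt0 // subr_le0 Hle // ltW //= (le_trans (ltW ut)).
  - apply: continuous_in_subspaceT => u; rewrite inE /= in_itv /= => ust.
    apply/differentiable_continuous/derivable1_diffP.
    by have [] := dg u ust.
  - exact: lexx.
  - exact: st.
  - exact: lexx.
rewrite /g subrr mulr0 expR0 mul1r mulNr expRN mulrC ler_pdivrMr ?expR_gt0 //.
by rewrite mulrC.
Qed.

(** Scalar comparison applied to [tr (M^T M) + g ^+ 2]: adding the constant
    turns an affine differential inequality into a linear one. *)
Lemma mx_gronwall m n (M L : R -> 'M[R]_(m, n)) (k g s T : R) :
  0 <= k -> 0 <= g ->
  (forall t, s <= t <= T -> is_derive t (1 : R) M (L t)) ->
  (forall t, s <= t <= T -> `|L t| <= k * (`|M t| + g)) ->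
  forall t, s <= t <= T ->
  `|M t| ^+ 2 <= expR (4 * (m * n)%:R * k * (t - s)) *
                 ((m * n)%:R * `|M s| ^+ 2 + g ^+ 2).
Proof.
move=> k0 g0 dM Lk t tsT.
pose f u := \tr ((M u)^T *m M u) + g ^+ 2.
have df u : s <= u <= T -> is_derive u (1 : R) f (2 * \tr ((M u)^T *m L u)).
  move=> /dM dMu.
  have dtr := is_derive_mxtrace (is_derive_mulmx (is_derive_trmx dMu) dMu).
  apply: (is_derive_eq (is_deriveD dtr (is_derive_cst (g ^+ 2) u 1))).
  rewrite addr0 mxtraceD [X in X + _](_ : _ = \tr ((M u)^T *m L u)); first by ring.
  by rewrite -mxtrace_tr trmx_mul trmxK.
have fle u : s <= u <= T ->
    2 * \tr ((M u)^T *m L u) <= 4 * (m * n)%:R * k * f u.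
  move=> usT; have h1 := frobenius_le (M u) (L u).
  have h2 := Lk u usT; have h3 := mx_norm_frobenius (M u).
  set q := (m * n)%:R in h1 *; have q0 : 0 <= q by [].
  have M0 : 0 <= `|M u| by [].
  have h4 : q * `|M u| * `|L u| <= q * `|M u| * (k * (`|M u| + g)).
    by rewrite ler_wpM2l // mulr_ge0.
  have h5 : `|M u| * (`|M u| + g) <= 2 * f u.
    rewrite /f; have := sqr_ge0 (`|M u| - g); nra.
  have h6 : q * k * (`|M u| * (`|M u| + g)) <= q * k * (2 * f u).
    by rewrite ler_wpM2l // mulr_ge0.
  nra.
have := gronwall df fle tsT; rewrite /f => ft.
apply: (@le_trans _ _ (\tr ((M t)^T *m M t) + g ^+ 2)).
  by rewrite -[leLHS]addr0 lerD ?mx_norm_frobenius // sqr_ge0.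
apply: (le_trans ft); rewrite ler_wpM2l ?expR_ge0 // lerD2r.
by rewrite (le_trans (frobenius_le _ _)) // expr2 mulrA.
Qed.

(** Liouville's formula [(det D)' = tr (P + K) det D] keeps [(det D)^2] away
    from zero, by comparison with an exponential. *)
Lemma unitmx_of_bilinear_ode n (D P K : R -> 'M[R]_n) (k s T : R) :
  (forall t, s <= t <= T ->
     is_derive t (1 : R) D (P t *m D t + D t *m K t)) ->
  (forall t, s <= t <= T -> `|P t| <= k /\ `|K t| <= k) ->
  D s \in unitmx ->
  forall t, s <= t <= T -> D t \in unitmx.
Proof.
move=> dD bnd Ds t tsT.
pose f u := - (\det (D u) ^+ 2).
have df u : s <= u <= T ->
    is_derive u (1 : R) f (2 * (\tr (P u) + \tr (K u)) * f u).
  move=> /dD/is_derive_det dd.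
  apply: (is_derive_eq (is_deriveN (is_deriveX 2 dd))).
  rewrite mulmxDl mxtraceD -mulmxA mul_mx_adj mul_mx_scalar mxtraceZ.
  rewrite -mulmxA mxtrace_mulC -mulmxA mul_adj_mx mul_mx_scalar mxtraceZ /f.
  rewrite /GRing.scale /=; ring.
have trle (X : 'M[R]_n) : `|X| <= k -> - (n%:R * k) <= \tr X.
  move=> Xk; rewrite lerNl (le_trans (ler_norm _)) // normrN.
  rewrite (le_trans (ler_norm_sum _ _ _)) // -[n in n%:R]card_ord mulr_natl.
  rewrite -sumr_const; apply: ler_sum => i _.
  exact: le_trans (mx_norm_ge _ _ _) Xk.
have fle u : s <= u <= T ->
    2 * (\tr (P u) + \tr (K u)) * f u <= - (4 * n%:R * k) * f u.
  move=> /bnd[/trle Pk /trle Kk].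
  have f0 : f u <= 0 by rewrite oppr_le0 sqr_ge0.
  rewrite ler_wnM2r //; lra.
have := gronwall df fle tsT; rewrite /f mulrN lerN2 => ft.
rewrite unitmxE unitfE -sqrf_eq0 gt_eqF // (lt_le_trans _ ft) //.
rewrite mulr_gt0 ?expR_gt0 // lt_neqAle sqr_ge0 andbT eq_sym sqrf_eq0.
by rewrite -unitfE -unitmxE.
Qed.

End Gronwall.

(** * Positive semidefinite matrices *)

Section Loewner.
Variable R : realType.

Lemma psdD n (M N : 'M[R]_n) : psd M -> psd N -> psd (M + N).
Proof.
move=> [Ms M0] [Ns N0]; split=> [|x]; first by rewrite linearD /= Ms Ns.
by rewrite mulmxDr mulmxDl mxE addr_ge0.
Qed.

Lemma psdZ n (a : R) (M : 'M[R]_n) : 0 <= a -> psd M -> psd (a *: M).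
Proof.
move=> a0 [Ms M0]; split=> [|x]; first by rewrite linearZ /= Ms.
by rewrite -scalemxAr -scalemxAl mxE mulr_ge0.
Qed.

Lemma psd_conj m n (M : 'M[R]_m) (B : 'M[R]_(m, n)) :
  psd M -> psd (B^T *m M *m B).
Proof.
move=> [Ms M0]; split=> [|x]; first by rewrite !trmx_mul trmxK Ms mulmxA.
by have := M0 (B *m x); rewrite trmx_mul !mulmxA.
Qed.

Lemma psd_conj_sym n (M B : 'M[R]_n) : B^T = B -> psd M -> psd (B *m M *m B).
Proof. by move=> Bs /(psd_conj B); rewrite Bs. Qed.

Lemma spd_conj m n (M : 'M[R]_m) (B : 'M[R]_(m, n)) :
  spd M -> (forall x : 'cV[R]_n, B *m x = 0 -> x = 0) -> spd (B^T *m M *m B).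
Proof.
move=> [Ms M0] Binj; split=> [|x x0]; first by rewrite !trmx_mul trmxK Ms mulmxA.
have /M0 : B *m x != 0 by apply: contra_neq x0 => /Binj.
by rewrite trmx_mul !mulmxA.
Qed.

Lemma spd_psd n (M : 'M[R]_n) : spd M -> psd M.
Proof.
move=> [Ms M0]; split=> // x; have [->|/M0/ltW//] := eqVneq x 0.
by rewrite mulmx0 mxE.
Qed.

Lemma dotmx_ge0 n (x : 'cV[R]_n) : 0 <= (x^T *m x) 0 0.
Proof. by rewrite mxE sumr_ge0 // => i _; rewrite mxE -expr2 sqr_ge0. Qed.

Lemma dotmx_gt0 n (x : 'cV[R]_n) : x != 0 -> 0 < (x^T *m x) 0 0.
Proof.
move=> x0; rewrite lt_neqAle dotmx_ge0 andbT eq_sym.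
apply: contra_neq x0; rewrite mxE => /eqP; rewrite psumr_eq0 => [/allP xi|i _]; last first.
  by rewrite mxE -expr2 sqr_ge0.
apply/colP => i; have := xi i (mem_index_enum _).
by rewrite !mxE mulf_eq0 orbb => /eqP.
Qed.

Lemma spd_scalar n (a : R) : 0 < a -> spd (a%:M : 'M[R]_n).
Proof.
move=> a0; split=> [|x x0]; first by rewrite tr_scalar_mx.
by rewrite mul_mx_scalar -scalemxAl mxE mulr_gt0 // dotmx_gt0.
Qed.

Lemma psd_spdD n (M N : 'M[R]_n) : psd M -> spd N -> spd (M + N).
Proof.
move=> [Ms M0] [Ns N0]; split=> [|x x0]; first by rewrite linearD /= Ms Ns.
by rewrite mulmxDr mulmxDl mxE ltr_wpDl // N0.
Qed.

Lemma spd_unitmx n (M : 'M[R]_n) : spd M -> M \in unitmx.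
Proof.
move=> [Ms M0]; rewrite -row_free_unit; apply: inj_row_free => v vM.
have [//|v0] := eqVneq v 0; have := M0 v^T.
rewrite trmx_eq0 trmxK vM mul0mx mxE ltxx => /(_ v0) //.
Qed.

Lemma spd_invmx n (M : 'M[R]_n) : spd M -> spd (invmx M).
Proof.
move=> Mspd; have Mu := spd_unitmx Mspd.
have -> : invmx M = (invmx M)^T *m M *m invmx M.
  by rewrite trmx_inv Mspd.1 mulVmx // mul1mx.
apply: spd_conj => // x; move/(congr1 (mulmx M)).
by rewrite mulmxA mulmxV // mul1mx mulmx0.
Qed.

(** Since [M] commutes with its inverse, [M^-1 - l^-1] is the sum of
    [l^-2 (l - M)] and [(1 - l^-1 M) M^-1 (1 - l^-1 M)]: antitonicity of the
    inverse against scalars, without square roots or eigenvalues. *)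
Lemma psd_inv_ge n (M : 'M[R]_n) (l : R) : 0 < l -> spd M ->
  psd (l%:M - M) -> psd (invmx M - l^-1%:M).
Proof.
move=> l0 Mspd lM; have Mu := spd_unitmx Mspd.
have -> : invmx M - l^-1%:M = l^-1 ^+ 2 *: (l%:M - M) +
    (1%:M - l^-1 *: M) *m invmx M *m (1%:M - l^-1 *: M).
  rewrite mulmxBl mul1mx -scalemxAl mulmxV // mulmxBr mulmx1 -scalemxAr.
  rewrite mulmxBl mulVmx // -scalemxAl mul1mx.
  apply/matrixP => i j; rewrite !mxE; field; exact: lt0r_neq0.
apply: psdD; first by apply: psdZ => //; exact: sqr_ge0.
apply: psd_conj_sym; last exact/spd_psd/spd_invmx.
by rewrite linearB /= trmx1 linearZ /= Mspd.1.
Qed.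

(** As above, from
    [l^-1 - M^-1 = M^-1 (M - l) M^-1 + l^-1 (1 - l M^-1) ^+ 2]. *)
Lemma psd_inv_le n (M : 'M[R]_n) (l : R) : 0 < l -> spd M ->
  psd (M - l%:M) -> psd (l^-1%:M - invmx M).
Proof.
move=> l0 Mspd lM; have Mu := spd_unitmx Mspd.
have -> : l^-1%:M - invmx M = invmx M *m (M - l%:M) *m invmx M +
    l^-1 *: ((1%:M - l *: invmx M) *m 1%:M *m (1%:M - l *: invmx M)).
  rewrite mulmxBr mulVmx // mul_mx_scalar mulmx1 !mulmxBl !mul1mx.
  rewrite mulmxBr mulmx1 -!scalemxAl -scalemxAr.
  apply/matrixP => i j; rewrite !mxE; field; exact: lt0r_neq0.
have Is : (invmx M)^T = invmx M by rewrite trmx_inv Mspd.1.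
apply: psdD; first exact: psd_conj_sym.
apply: psdZ; first by rewrite invr_ge0 ltW.
apply: psd_conj_sym; last exact/spd_psd/spd_scalar.
by rewrite linearB /= trmx1 linearZ /= Is.
Qed.

Lemma quad_scalar n (a : R) (x : 'cV[R]_n) :
  (x^T *m a%:M *m x) 0 0 = a * (x^T *m x) 0 0.
Proof. by rewrite mul_mx_scalar -scalemxAl mxE. Qed.

Lemma quadB n (M N : 'M[R]_n) (x : 'cV[R]_n) :
  (x^T *m (M - N) *m x) 0 0 = (x^T *m M *m x) 0 0 - (x^T *m N *m x) 0 0.
Proof.
rewrite mulmxBr mulmxBl; set P := _ *m M *m x; set Q := _ *m N *m x.
by rewrite !mxE.
Qed.

Lemma quadmxE n (M : 'M[R]_n) (x : 'cV[R]_n) :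
  (x^T *m M *m x) 0 0 = \sum_i \sum_j x i 0 * M i j * x j 0.
Proof.
rewrite mxE exchange_big; apply: eq_bigr => j _; rewrite mxE big_distrl.
by apply: eq_bigr => i _; rewrite mxE.
Qed.

(** Each product [x_i x_j] is at most the half-sum of the squares; summing
    over both indices produces the factor [n]. *)
Lemma psd_norm_sub n (M : 'M[R]_n) (l : R) : M^T = M -> n%:R * `|M| <= l ->
  psd (l%:M - M).
Proof.
move=> Ms Ml; split=> [|x]; first by rewrite linearB /= tr_scalar_mx Ms.
rewrite quadB subr_ge0 quad_scalar quadmxE.
apply: (@le_trans _ _ (n%:R * `|M| * (x^T *m x) 0 0)); last first.
  by rewrite ler_wpM2r // dotmx_ge0.
apply: (@le_trans _ _
    (\sum_i \sum_j `|M| * (2^-1 * (x i 0 ^+ 2 + x j 0 ^+ 2)))).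
  apply: ler_sum => i _; apply: ler_sum => j _.
  rewrite (le_trans (ler_norm _)) // !normrM.
  have h1 := mx_norm_ge M i j.
  have h2 : 2 * `|x i 0| * `|x j 0| <= x i 0 ^+ 2 + x j 0 ^+ 2.
    rewrite -(real_normK (num_real (x i 0))) -(real_normK (num_real (x j 0))).
    have := sqr_ge0 (`|x i 0| - `|x j 0|); nra.
  have h3 : 0 <= `|x i 0| * `|x j 0| by rewrite mulr_ge0.
  have h4 : `|M i j| * (`|x i 0| * `|x j 0|) <= `|M| * (`|x i 0| * `|x j 0|).
    by rewrite ler_wpM2r.
  have M0 : 0 <= `|M| by []. nra.
rewrite mxE le_eqVlt; apply/orP; left; apply/eqP.
transitivity (\sum_i `|M| * (2^-1 * (n%:R * x i 0 ^+ 2 + \sum_j x j 0 ^+ 2))).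
  apply: eq_bigr => i _.
  by rewrite -!mulr_sumr big_split /= sumr_const card_ord mulr_natl.
rewrite -!mulr_sumr big_split /= sumr_const card_ord -mulr_sumr -[X in _ + X]mulr_natl.
under [X in _ = _ * X]eq_bigr do rewrite mxE -expr2.
by field.
Qed.

Lemma psd_diag_ge0 n (M : 'M[R]_n) i : psd M -> 0 <= M i i.
Proof.
move=> [_ /(_ (delta_mx i 0))]; rewrite trmx_delta -rowE -colE.
by rewrite !mxE.
Qed.

(** Evaluate the quadratic form at [e_i + e_j] and at [e_i - e_j]. *)
Lemma psd_entry_le n (M : 'M[R]_n) i j :
  psd M -> `|M i j| <= 2^-1 * (M i i + M j j).
Proof.
move=> [Ms M0]; have sij : M j i = M i j by rewrite -{1}Ms mxE.
have q (a : R) : 0 <= M i i + a * M i j + (a * M j i + a * a * M j j).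
  have := M0 (delta_mx i 0 + a *: delta_mx j 0).
  rewrite [X in X *m _ *m _]linearD linearZ /= !trmx_delta.
  rewrite mulmxDl -scalemxAl -!rowE.
  rewrite mulmxDr -scalemxAr -!colE !mxE; nra.
have := q 1; have := q (-1); rewrite sij ler_norml => h1 h2.
apply/andP; split; nra.
Qed.

Lemma psd_norm_le n (M N : 'M[R]_n) : psd M -> psd (N - M) -> `|M| <= `|N|.
Proof.
move=> Mpsd NM; apply: mx_norm_le => // i j.
apply: (le_trans (psd_entry_le i j Mpsd)).
have d k : M k k <= `|N|.
  have := psd_diag_ge0 k NM; rewrite !mxE subr_ge0 => /le_trans; apply.
  exact: le_trans (ler_norm _) (mx_norm_ge _ _ _).
have := d i; have := d j; lra.
Qed.

(** The smallest eigenvalue is avoided: an upper bound on the inverse by a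
    scalar matrix is a lower bound on the matrix. *)
Lemma spd_ge_scalar n (M : 'M[R]_n) : spd M ->
  exists2 m : R, 0 < m & psd (M - m%:M).
Proof.
move=> Mspd; have Ispd := spd_invmx Mspd.
pose l := n%:R * `|invmx M| + 1; have l0 : 0 < l.
  by rewrite /l ltr_wpDl // mulr_ge0.
exists l^-1; first by rewrite invr_gt0.
rewrite -{1}(invmxK M); apply: psd_inv_ge => //.
by apply: psd_norm_sub; [exact: Ispd.1 | rewrite /l lerDl].
Qed.

(** Induction on the size: subtracting from [P] its rank-one part
    [P_00^-1 p p^T], where [p] is the first column of [P], leaves the Schur
    complement of [P_00], which is again positive definite. *)
Lemma mxtrace_psd_mul n (B P : 'M[R]_n) : psd B -> spd P -> 0 <= \tr (B *m P).
Proof.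
elim: n B P => [|n IH] B P Bpsd Pspd.
  by rewrite /mxtrace big_ord0.
move: B P Bpsd Pspd; rewrite -[n.+1]/(1 + n)%N => B P Bpsd Pspd.
have Ps : P^T = P := Pspd.1.
have a0 : 0 < P 0 0.
  have /Pspd.2 : (delta_mx 0 0 : 'cV[R]_(1 + n)) != 0.
    by apply/eqP => /matrixP /(_ 0 0); rewrite !mxE => /eqP; rewrite oner_eq0.
  by rewrite trmx_delta -rowE -colE !mxE.
set a := P 0 0 in a0; have a_neq0 : a != 0 by rewrite gt_eqF.
have ulP : ulsubmx P = a%:M.
  by rewrite [LHS]mx11_scalar !mxE /a; congr (P _ _)%:M; apply: val_inj.
pose u := ursubmx P.
have dlP : dlsubmx P = u^T by rewrite -{1}Ps trmx_ursub.
pose G : 'M[R]_(1 + n, n) := col_mx (- (a^-1 *: u)) 1%:M.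
have PE : P = block_mx a%:M u u^T (drsubmx P) by rewrite -ulP -dlP submxK.
have PG : G^T *m P *m G = drsubmx P - a^-1 *: (u^T *m u).
  rewrite -mulmxA {1}PE /G mul_block_col mulmx1 tr_col_mx mul_row_col.
  rewrite trmx1 mul1mx mul_scalar_mx scalerN scalerA mulfV // scale1r addNr.
  by rewrite mulmx0 add0r mulmxN mulmx1 -scalemxAr addrC.
pose H : 'M[R]_(1 + n, n) := col_mx 0 1%:M.
have BH : H^T *m B *m H = drsubmx B.
  rewrite -{1}[B]submxK /H tr_col_mx trmx0 trmx1 mul_row_block !mul0mx !add0r.
  by rewrite !mul1mx mul_row_col mulmx0 mulmx1 add0r.
have Gspd : spd (G^T *m P *m G).
  apply: spd_conj => // x; rewrite mul_col_mx mul1mx.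
  by rewrite -col_mx0 => /eq_col_mx[].
have := IH _ _ (psd_conj H Bpsd) Gspd; rewrite BH => trBG.
set p := (col_mx a%:M u^T : 'cV[R]_(1 + n)).
have -> : P = a^-1 *: (p *m p^T) + block_mx 0 0 0 (G^T *m P *m G).
  rewrite PG {1}PE tr_col_mx tr_scalar_mx trmxK mul_col_row scale_block_mx.
  rewrite add_block_mx !addr0 !mul_scalar_mx mul_mx_scalar !scalerA mulVf //.
  by rewrite !scale1r addrC subrK.
rewrite mulmxDr mxtraceD -scalemxAr mxtraceZ mulmxA mxtrace_mulC mulmxA.
rewrite addr_ge0 //.
  rewrite mulr_ge0 //; first by rewrite invr_ge0 ltW.
  rewrite trace_mx11; exact: Bpsd.2.
rewrite -[B]submxK mulmx_block !mulmx0 !addr0 !add0r mxtrace_block.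
by rewrite mxtrace0 add0r.
Qed.

End Loewner.

(** * Two-sided extension of one-sided derivatives, and the spectral norm *)

Section Bridges.
Variable R : realType.

(** Continuing [f] to the left of [s] along its tangent at [s] gives a function
    that is differentiable in the ordinary sense on the closed half-line, so
    that end points need no separate treatment afterwards. *)
Lemma is_derive_within_extend (V : normedModType R) (f l : R -> V) (s : R) :
  (forall t, s <= t -> is_derive_within `[s, +oo[ f t (l t)) ->
  exists g : R -> V, (forall t, s <= t -> g t = f t) /\
    forall t, s <= t -> is_derive t (1 : R) g (l t).
Proof.
move=> df; pose g t := if s <= t then f t else f s + (t - s) *: l s.
exists g; split=> [t st|t st]; first by rewrite /g st.
suff dg : h^-1 *: (g (h *: 1 + t) - g t) @[h --> (0 : R)^'] --> l t.
  by split; [apply/cvg_ex; exists (l t) | exact: cvg_lim dg].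
apply/cvgrPdist_le => e e0.
have := df t st => /cvgrPdist_le /(_ e e0).
rewrite near_withinE => dft.
have shiftE h : h *: (1 : R) + t = t + h by rewrite [h *: 1]mulr1 addrC.
have [ts|ts|ts] := ltgtP t s; first by move: st; rewrite leNgt ts.
- near=> h.
  have th : s <= t + h.
    have : `|h| < t - s by near: h; apply: dnbhs0_lt; rewrite subr_gt0.
    rewrite ltr_norml => /andP[]; lra.
  rewrite (shiftE h) /g st th; move: th; near: h.
  apply: filterS dft => h hle th; apply: hle; by rewrite /= in_itv /= th.
- near=> h.
  have h0 : h != 0 by near: h; exact: nbhs_dnbhs_neq.
  rewrite (shiftE h) /g st; case: ifPn => th.
    move: th; near: h.
    apply: filterS dft => h hle th; apply: hle; by rewrite /= in_itv /= th.
  rewrite ts addrAC subrr add0r (addrC s) addrK scalerA mulVf // scale1r subrr.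
  by rewrite normr0 ltW.
Unshelve. all: by end_near. Qed.

Lemma enorm_le m (y : 'cV[R]_m) : enorm y <= m%:R * `|y|.
Proof.
rewrite -[leRHS]ger0_norm ?mulr_ge0 // -sqrtr_sqr ler_sqrt ?sqr_ge0 //.
apply: (@le_trans _ _ (\sum_(i < m) `|y| ^+ 2)).
  apply: ler_sum => i _; rewrite -real_normK ?num_real //.
  by rewrite lerXn2r ?nnegrE // mx_norm_ge.
rewrite sumr_const card_ord -[leLHS]mulr_natl exprMn ler_wpM2r ?sqr_ge0 //.
rewrite -natrX ler_nat.
by rewrite -[leqLHS]expn1; case: m y => [|m] y //; rewrite leq_pexp2l.
Qed.

Lemma enorm_ge m (y : 'cV[R]_m) i : `|y i 0| <= enorm y.
Proof.
rewrite -sqrtr_sqr ler_sqrt ?sumr_ge0 // => [|j _]; last exact: sqr_ge0.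
by rewrite (bigD1 i) //= lerDl sumr_ge0 // => j _; exact: sqr_ge0.
Qed.

Lemma enorm_mul_le m n (M : 'M[R]_(m, n)) x :
  enorm x <= 1 -> enorm (M *m x) <= (m * n)%:R * `|M|.
Proof.
move=> x1; apply: (le_trans (enorm_le _)); rewrite natrM -mulrA ler_wpM2l //.
rewrite -[leRHS]mulr1; apply: mx_norm_mul_le => //.
apply: mx_norm_le => // j k; rewrite (ord1 k); exact: le_trans (enorm_ge _ _) x1.
Qed.

Lemma specnorm_le m n (M : 'M[R]_(m, n)) : specnorm M <= (m * n)%:R * `|M|.
Proof.
apply: ge_sup => [|_ [x /= x1 <-]]; last exact: enorm_mul_le.
exists (enorm (M *m 0)), 0 => //=.
by apply: (le_trans (enorm_le _)); rewrite normr0 mulr0.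
Qed.

Lemma specnorm_ge m n (M : 'M[R]_(m, n)) : `|M| <= specnorm M.
Proof.
have supM : has_ubound [set enorm (M *m x) | x in [set x | enorm x <= 1]].
  by exists ((m * n)%:R * `|M|) => _ [x /= x1 <-]; exact: enorm_mul_le.
have s0 : 0 <= specnorm M.
  apply: (@le_trans _ _ (enorm (M *m 0))); first exact: sqrtr_ge0.
  apply: ub_le_sup => //; exists 0 => //=.
  by apply: (le_trans (enorm_le _)); rewrite normr0 mulr0.
apply: mx_norm_le => // i j.
apply: (@le_trans _ _ (enorm (M *m delta_mx j 0))).
  by apply: le_trans (enorm_ge _ i); rewrite -colE mxE.
apply: ub_le_sup => //; exists (delta_mx j 0) => //=.
rewrite /enorm (bigD1 j) //= big1 => [|k kj]; last first.
  by rewrite mxE (negbTE kj) expr0n.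
by rewrite mxE !eqxx addr0 expr1n sqrtr1.
Qed.

End Bridges.

(** * Differences of Riccati solutions and their inverses *)

Lemma addmxE (V : nmodType) m n (M N : 'M[V]_(m, n)) i j :
  (M + N) i j = M i j + N i j.
Proof. by rewrite mxE. Qed.

Lemma oppmxE (V : zmodType) m n (M : 'M[V]_(m, n)) i j : (- M) i j = - M i j.
Proof. by rewrite mxE. Qed.

Lemma scalemxE (V : pzRingType) m n a (M : 'M[V]_(m, n)) i j :
  (a *: M) i j = a * M i j.
Proof. by rewrite mxE. Qed.

(** Identities between noncommutative polynomials in matrices: after complete
    expansion, the entries of the monomials are atoms of a commutative ring. *)
Ltac mxring :=
  rewrite ?(mulmxDl, mulmxDr, mulNmx, mulmxN, opprD, opprK, mulmxA);
  apply/matrixP => ? ?; rewrite !(addmxE, oppmxE); ring.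

Section Riccati.
Variables (R : realType) (n : nat).

Definition riccati_field (A S R1 P : 'M[R]_n) := A *m P + P *m A^T - P *m S *m P + R1.

Lemma riccati_fieldB (A S R1 P Q : 'M[R]_n) :
  riccati_field A S R1 P - riccati_field A S R1 Q =
  (A - P *m S) *m (P - Q) + (P - Q) *m (A^T - S *m Q).
Proof. rewrite /riccati_field; mxring. Qed.

Variables (A S : R -> 'M[R]_n) (R1 : 'M[R]_n).

Definition riccati_path (s T : R) (p : R -> 'M[R]_n) :=
  forall t, s <= t <= T ->
    is_derive t (1 : R) p (riccati_field (A t) (S t) R1 (p t)).

Definition drift (p : R -> 'M[R]_n) t := A t - p t *m S t.
(** For a symmetric [p] this is the transpose of the drift; stated this way,
    the identity for differences of solutions holds without symmetry. *)
Definition codrift (p : R -> 'M[R]_n) t := (A t)^T - S t *m p t.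

Lemma riccati_pathB s T p q t : riccati_path s T p -> riccati_path s T q ->
  s <= t <= T ->
  is_derive t (1 : R) (fun u => p u - q u)
    (drift p t *m (p t - q t) + (p t - q t) *m codrift q t).
Proof.
move=> dp dq tsT; rewrite /drift /codrift -(riccati_fieldB _ _ R1).
exact: is_deriveB (dp t tsT) (dq t tsT).
Qed.

Lemma drift_bound p t a b : `|A t| <= a -> `|S t| <= a -> `|p t| <= b ->
  `|drift p t| <= a + n%:R * a * b /\ `|codrift p t| <= a + n%:R * a * b.
Proof.
move=> Aa Sa pb; split; apply: (le_trans (ler_normB _ _)); apply: lerD => //.
- by rewrite (le_trans (mx_norm_mul_le pb Sa)) // mulrAC.
- exact: le_trans (mx_norm_trmx_le _) Aa.
- exact: mx_norm_mul_le.
Qed.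

Variables (s T a : R).
Hypothesis A_le : forall t, s <= t <= T -> `|A t| <= a.
Hypothesis S_le : forall t, s <= t <= T -> `|S t| <= a.

(** The difference solves a bilinear equation, whose solutions cannot become
    singular. *)
Lemma riccati_sub_unitmx p q : riccati_path s T p -> riccati_path s T q ->
  p s - q s \in unitmx -> forall t, s <= t <= T -> p t - q t \in unitmx.
Proof.
move=> dp dq pq0.
have [kp pk] := mx_bounded_segment dp; have [kq qk] := mx_bounded_segment dq.
apply: (@unitmx_of_bilinear_ode _ _ (fun u => p u - q u) (drift p) (codrift q)
  (a + n%:R * a * Num.max kp kq)).
- by move=> t tsT; exact: riccati_pathB tsT.
- move=> t tsT; split.
    apply: (drift_bound (A_le tsT) (S_le tsT) _).1.
    by rewrite le_max pk.
  apply: (drift_bound (A_le tsT) (S_le tsT) _).2.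
  by rewrite le_max qk // orbT.
- exact: pq0.
Qed.

(** In the chart [p |-> (p - q)^-1] the quadratic term of the Riccati equation
    becomes the constant term [S]: the equation is affine, and its linear part
    involves the reference solution [q] only. *)
Lemma is_derive_chart p q t : riccati_path s T p -> riccati_path s T q ->
  p t - q t \in unitmx -> s <= t <= T ->
  is_derive t (1 : R) (fun u => invmx (p u - q u))
    (S t - invmx (p t - q t) *m drift q t - codrift q t *m invmx (p t - q t)).
Proof.
move=> dp dq Du tsT.
apply: (is_derive_eq (is_derive_invmx Du (riccati_pathB dp dq tsT))).
have -> : drift p t = drift q t - (p t - q t) *m S t by rewrite /drift; mxring.
set D := p t - q t in Du *; set Z := invmx D.
have ZD : Z *m D = 1%:M by rewrite mulVmx.
have DZ : D *m Z = 1%:M by rewrite mulmxV.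
rewrite mulmxDr mulmxDl.
rewrite -(mulmxA _ (_ *m D) Z) -(mulmxA _ D Z) DZ mulmx1.
rewrite (mulmxA Z D) ZD mul1mx mulmxBr (mulmxA Z D) ZD mul1mx.
mxring.
Qed.

(** The constants depend on [p] through the initial value only: this is what
    allows [p] to start arbitrarily far away. *)
Lemma chart_bound a' p q : riccati_path s T p -> riccati_path s T q ->
  (forall t, s <= t <= T -> `|drift q t| <= a' /\ `|codrift q t| <= a') ->
  a <= a' -> p s - q s \in unitmx ->
  forall t, s <= t <= T ->
  `|invmx (p t - q t)| ^+ 2 <=
    expR (4 * (n * n)%:R * (2 * n%:R * a' + a') * (t - s)) *
    ((n * n)%:R * `|invmx (p s - q s)| ^+ 2 + 1).
Proof.
move=> dp dq bq aa' pq0 t tsT.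
have a'0 : 0 <= a' by apply: (le_trans _ (bq t tsT).1).
have n0 : 0 <= n%:R :> R by [].
have pqu := riccati_sub_unitmx dp dq pq0.
have k0 : 0 <= 2 * n%:R * a' + a' by rewrite addr_ge0 // !mulr_ge0.
have dZ u (usT : s <= u <= T) := is_derive_chart dp dq (pqu u usT) usT.
have := mx_gronwall k0 ler01 dZ _ tsT; rewrite expr1n; apply.
move=> u usT /=; have [b1 b2] := bq u usT.
set Z := invmx _; have Z0 : 0 <= `|Z| by [].
have h1 := mx_norm_mul_le (lexx `|Z|) b1.
have h2 := mx_norm_mul_le b2 (lexx `|Z|).
have h3 := le_trans (S_le usT) aa'.
apply: (le_trans (ler_normB _ _)); apply: (le_trans (lerD (ler_normB _ _) (lexx _))).
have : 0 <= n%:R * a' by rewrite mulr_ge0.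
nra.
Qed.

(** Each [G_i = D_ab (D_ai)^-1 D_ab] satisfies
    [G_i' = F_b G_i + G_i H_b - D_ab S D_ab]: conjugation by [D_ab] exchanges
    the drift of the far solution [pa] for that of the reference [pb].  The
    source term is common to both [G_i], so their difference [N] solves a
    linear equation whose coefficients do not involve [pa]. *)
Lemma conj_chart_bound a' pa pb p1 p2 :
  riccati_path s T pa -> riccati_path s T pb ->
  riccati_path s T p1 -> riccati_path s T p2 ->
  (forall t, s <= t <= T -> `|drift pb t| <= a' /\ `|codrift pb t| <= a') ->
  pa s - p1 s \in unitmx -> pa s - p2 s \in unitmx ->
  let N t := (pa t - pb t) *m
    (invmx (pa t - p1 t) - invmx (pa t - p2 t)) *m (pa t - pb t) in
  forall t, s <= t <= T ->
  `|N t| ^+ 2 <= expR (4 * (n * n)%:R * (2 * n%:R * a') * (t - s)) *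
    ((n * n)%:R * `|N s| ^+ 2).
Proof.
move=> da db d1 d2 bb u1 u2 N t tsT.
have a'0 : 0 <= a' by apply: (le_trans _ (bb t tsT).1).
pose G q u := (pa u - pb u) *m invmx (pa u - q u) *m (pa u - pb u).
have dG q u : riccati_path s T q -> pa s - q s \in unitmx -> s <= u <= T ->
    is_derive u (1 : R) (G q) (drift pb u *m G q u + G q u *m codrift pb u
      - (pa u - pb u) *m S u *m (pa u - pb u)).
  move=> dq uq usT; have qu := riccati_sub_unitmx da dq uq usT.
  have dab := riccati_pathB da db usT.
  have daq := is_derive_invmx qu (riccati_pathB da dq usT).
  apply: (is_derive_eq (is_derive_mulmx (is_derive_mulmx dab daq) dab)).
  rewrite /G.
  (* The outer factors are differentiated differently, so that only the drift
     of [pb] ends up on the far left and its codrift on the far right. *)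
  have e1 : drift pa u *m (pa u - pb u) + (pa u - pb u) *m codrift pb u =
      drift pb u *m (pa u - pb u) + (pa u - pb u) *m codrift pa u.
    by rewrite /drift /codrift; mxring.
  have e2 : codrift q u = codrift pa u + S u *m (pa u - q u).
    by rewrite /codrift; mxring.
  rewrite {1}e1 e2.
  move: qu; set E := pa u - q u; set D := pa u - pb u => qu.
  set Z := invmx E.
  have ZE : Z *m E = 1%:M by rewrite mulVmx.
  have EZ : E *m Z = 1%:M by rewrite mulmxV.
  have -> : Z *m (drift pa u *m E + E *m (codrift pa u + S u *m E)) *m Z =
      Z *m drift pa u + codrift pa u *m Z + S u.
    rewrite mulmxDr mulmxDl -(mulmxA _ (_ *m E) Z) -(mulmxA _ E Z) EZ mulmx1.
    rewrite (mulmxA Z E) ZE mul1mx mulmxDl -(mulmxA _ E Z) EZ mulmx1 addrA.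
    by [].
  move: (drift pa u) (drift pb u) (codrift pa u) (codrift pb u) (S u).
  clearbody Z D; move=> Fa Fb Ha Hb Su {ZE EZ e1 e2}.
  mxring.
have NE u : N u = G p1 u - G p2 u by rewrite /N /G -mulmxBl -mulmxBr.
have dN u : s <= u <= T ->
    is_derive u (1 : R) N (drift pb u *m N u + N u *m codrift pb u).
  move=> usT; have -> : N = (fun u => G p1 u - G p2 u) by apply/funext.
  apply: (is_derive_eq (is_deriveB (dG _ _ d1 u1 usT) (dG _ _ d2 u2 usT))).
  mxring.
have k0 : 0 <= 2 * n%:R * a' by rewrite !mulr_ge0.
have := mx_gronwall k0 (lexx 0) dN _ tsT; rewrite expr0n addr0; apply.
move=> u usT /=; have [b1 b2] := bb u usT.
have h1 := mx_norm_mul_le (lexx `|N u|) b2.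
have h2 := mx_norm_mul_le b1 (lexx `|N u|).
apply: (le_trans (ler_normD _ _)); nra.
Qed.

End Riccati.

(** * Uniform Lipschitz estimate at a fixed time *)

Section Lipschitz.
Variables (R : realType) (n : nat).

(** With [M = (l - Q)^-1], the identity [l M = 1 + M Q] gives
    [l |M| <= 1 + (l / 2) |M|]. *)
Lemma resolvent_bound (Q : 'M[R]_n) (l : R) :
  0 < l -> 2 * n%:R * `|Q| <= l -> Q^T = Q ->
  l%:M - Q \in unitmx /\ l * `|invmx (l%:M - Q)| <= 2.
Proof.
move=> l0 Ql Qs.
have u : l%:M - Q \in unitmx.
  apply: spd_unitmx.
  have -> : l%:M - Q = ((l / 2)%:M - Q) + (l / 2)%:M.
    by rewrite addrAC -raddfD -splitr.
  apply: psd_spdD; last by apply: spd_scalar; lra.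
  by apply: psd_norm_sub => //; lra.
split=> //; set M := invmx _.
have lM : l *: M = 1%:M + M *m Q.
  have := mulVmx u; rewrite mulmxBr mul_mx_scalar -/M => /eqP.
  by rewrite subr_eq => /eqP.
have : `|l *: M| <= 1 + n%:R * `|M| * `|Q|.
  rewrite lM (le_trans (ler_normD _ _)) // lerD //; last exact: mx_norm_mul.
  by rewrite (le_trans (mx_norm_scalar_le _ _)) // normr1.
rewrite normrZ (gtr0_norm l0) => h.
have M0 : 0 <= `|M| by [].
nra.
Qed.

Variables (A S : R -> 'M[R]_n) (R1 : 'M[R]_n) (T a b : R).
Hypothesis T0 : 0 <= T.
Hypothesis A_le : forall t, 0 <= t <= T -> `|A t| <= a.
Hypothesis S_le : forall t, 0 <= t <= T -> `|S t| <= a.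
Variable psi : 'M[R]_n -> R -> 'M[R]_n.
Hypothesis psi0 : forall Q, spd Q -> psi Q 0 = Q.
Hypothesis psi_path : forall Q, spd Q -> riccati_path A S R1 0 T (psi Q).
Hypothesis psi_le : forall Q, spd Q -> `|psi Q T| <= b.

Lemma riccati_flow_lipschitz : exists2 K : R, 0 <= K &
  forall Q1 Q2, spd Q1 -> spd Q2 -> `|psi Q1 T - psi Q2 T| <= K * `|Q1 - Q2|.
Proof.
have TT : 0 <= T <= T by rewrite T0 lexx.
have n0 : 0 <= n%:R :> R by [].
have I_spd : spd (1%:M : 'M[R]_n) by exact: spd_scalar.
have db := psi_path I_spd.
have [kb kbP] := mx_bounded_segment db.
pose a' := a + n%:R * a * kb.
have bb t : 0 <= t <= T ->
    `|drift A S (psi 1%:M) t| <= a' /\ `|codrift A S (psi 1%:M) t| <= a'.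
  by move=> tT; apply: drift_bound; [exact: A_le | exact: S_le | exact: kbP].
have a0 : 0 <= a by exact: le_trans (A_le TT).
have kb0 : 0 <= kb by exact: le_trans (kbP _ TT).
have aa' : a <= a' by rewrite /a' lerDl !mulr_ge0.
have b0 : 0 <= b by exact: le_trans (psi_le I_spd).
pose q : R := (n * n)%:R.
pose kZ := expR (4 * q * (2 * n%:R * a' + a') * (T - 0)) * (q + 1).
pose kN := expR (4 * q * (2 * n%:R * a') * (T - 0)) * q.
have kZ0 : 0 <= kZ by rewrite mulr_ge0 ?expR_ge0 // addr_ge0.
have kN0 : 0 <= kN by rewrite mulr_ge0 ?expR_ge0.
pose kD := 2 * b.
pose z := Num.sqrt kZ; pose nn := Num.sqrt kN * (4 * n%:R * n%:R).
exists (n%:R * (n%:R * (n%:R * (n%:R * kD * z) * nn) * z) * kD).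
  by rewrite !mulr_ge0 // sqrtr_ge0.
move=> Q1 Q2 Q1spd Q2spd.
(* Large enough for both resolvents to be bounded by [2 / l], while keeping
   [l - 1 >= 1]. *)
pose l : R := 2 * n%:R * (`|Q1| + `|Q2|) + 2.
have Q1n : 0 <= `|Q1| by []. have Q2n : 0 <= `|Q2| by [].
have l2 : 2 <= l by rewrite /l lerDr !mulr_ge0 // addr_ge0.
have l0 : 0 < l by lra.
have l_spd : spd (l%:M : 'M[R]_n) by exact: spd_scalar.
have da := psi_path l_spd.
have d1 := psi_path Q1spd; have d2 := psi_path Q2spd.
have [u1 r1] : l%:M - Q1 \in unitmx /\ l * `|invmx (l%:M - Q1)| <= 2.
  by apply: resolvent_bound Q1spd.1 => //; rewrite /l; nra.
have [u2 r2] : l%:M - Q2 \in unitmx /\ l * `|invmx (l%:M - Q2)| <= 2.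
  by apply: resolvent_bound Q2spd.1 => //; rewrite /l; nra.
have l1 : 0 < l - 1 by lra.
have ub : psi l%:M 0 - psi 1%:M 0 \in unitmx.
  by rewrite !psi0 // -raddfB; exact/spd_unitmx/spd_scalar.
have u1' : psi l%:M 0 - psi Q1 0 \in unitmx by rewrite !psi0.
have u2' : psi l%:M 0 - psi Q2 0 \in unitmx by rewrite !psi0.
have hZ := chart_bound A_le S_le da db bb aa' ub TT.
have := conj_chart_bound A_le S_le da db d1 d2 bb u1' u2' TT => /=.
rewrite !psi0 //; set N := _ *m _ *m _; set N0 := _ *m _ *m _ => hN.
have Zle : `|invmx (psi l%:M T - psi 1%:M T)| <= z.
  rewrite -[leLHS]ger0_norm // -sqrtr_sqr; apply: ler_wsqrtr.
  apply: (le_trans hZ); rewrite /kZ ler_wpM2l ?expR_ge0 // lerD2r.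
  rewrite !psi0 // -raddfB /= -scalemx1 invmxZ; last first.
    by rewrite scalemx1; exact/spd_unitmx/spd_scalar.
  have I1 : `|1%:M : 'M[R]_n| <= 1.
    by rewrite (le_trans (mx_norm_scalar_le _ _)) // normr1.
  have l1' : (l - 1)^-1 <= 1 by rewrite invf_le1 //; lra.
  have l10 : 0 <= (l - 1)^-1 by rewrite invr_ge0 ltW.
  rewrite invmx1 normrZ ger0_norm // -[leRHS]mulr1 ler_wpM2l //.
  by rewrite exprn_ile1 ?mulr_ge0 // mulr_ile1.
have N0le : `|N0| <= 4 * n%:R * n%:R * `|Q1 - Q2|.
  have -> : N0 = (l - 1) ^+ 2 *:
      (invmx (l%:M - Q1) *m (Q1 - Q2) *m invmx (l%:M - Q2)).
    rewrite /N0 -raddfB /= mul_scalar_mx mul_mx_scalar scalerA -expr2.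
    congr (_ *: _).
    have -> : Q1 - Q2 = (l%:M - Q2) - (l%:M - Q1).
      by rewrite opprB [RHS]addrC addrA subrK.
    by rewrite mulmxBr mulVmx // mulmxBl mul1mx mulmxK.
  rewrite normrZ ger0_norm ?sqr_ge0 //.
  set X1 := invmx _ in r1 *; set X2 := invmx (_ - Q2) in r2 *.
  have X10 : 0 <= `|X1| by []. have X20 : 0 <= `|X2| by [].
  have h := mx_norm_mul_le (mx_norm_mul X1 (Q1 - Q2)) (lexx `|X2|).
  apply: (le_trans (ler_wpM2l (sqr_ge0 _) h)).
  have y1 : (l - 1) * `|X1| <= 2 by nra.
  have y2 : (l - 1) * `|X2| <= 2 by nra.
  have y12 : ((l - 1) * `|X1|) * ((l - 1) * `|X2|) <= 2 * 2.
    by rewrite ler_pM // mulr_ge0 // ltW.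
  have -> : (l - 1) ^+ 2 * (n%:R * (n%:R * `|X1| * `|Q1 - Q2|) * `|X2|) =
    (((l - 1) * `|X1|) * ((l - 1) * `|X2|)) * (n%:R * n%:R * `|Q1 - Q2|) by ring.
  have -> : 4 * n%:R * n%:R * `|Q1 - Q2| = (2 * 2) * (n%:R * n%:R * `|Q1 - Q2|) by ring.
  by rewrite ler_wpM2r // !mulr_ge0.
have Nle : `|N| <= nn * `|Q1 - Q2|.
  have : `|N| ^+ 2 <= (Num.sqrt kN * `|N0|) ^+ 2.
    by rewrite exprMn sqr_sqrtr // /kN -[leRHS]mulrA; exact: hN.
  rewrite ler_pXn2r ?nnegrE ?mulr_ge0 ?sqrtr_ge0 // => /le_trans; apply.
  by rewrite /nn -mulrA ler_wpM2l ?sqrtr_ge0.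
have uabT := riccati_sub_unitmx A_le S_le da db ub TT.
have u1T := riccati_sub_unitmx A_le S_le da d1 u1' TT.
have u2T := riccati_sub_unitmx A_le S_le da d2 u2' TT.
have Dle Q : spd Q -> `|psi l%:M T - psi Q T| <= kD.
  move=> Qspd; apply: (le_trans (ler_normB _ _)).
  by rewrite /kD mulr_natl mulr2n lerD // psi_le.
have -> : psi Q1 T - psi Q2 T = (psi l%:M T - psi Q1 T) *m
    invmx (psi l%:M T - psi 1%:M T) *m N *m invmx (psi l%:M T - psi 1%:M T) *m
    (psi l%:M T - psi Q2 T).
  rewrite /N !mulmxA mulmxKV // mulmxK // (mulmxBr _ (invmx _)) mulmxV //.
  rewrite mulmxBl mul1mx.
  by rewrite mulmxKV // opprB [RHS]addrC addrA subrK.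

have := mx_norm_mul_le (mx_norm_mul_le (mx_norm_mul_le
  (mx_norm_mul_le (Dle _ Q1spd) Zle) Nle) Zle) (Dle _ Q2spd).
move=> /le_trans; apply; rewrite le_eqVlt; apply/orP; left; apply/eqP.
by rewrite /nn; ring.
Qed.

End Lipschitz.

(** * Exponential decay under two-sided bounds *)

Section Decay.
Variables (R : realType) (n : nat).
Implicit Types D X Y B : 'M[R]_n.

(** Cyclicity turns the trace into that of [(D B D) Y]. *)
Lemma psd_quad_trace B Y D : D^T = D -> psd B -> spd Y ->
  0 <= \tr (B *m D *m Y *m D).
Proof.
move=> Ds Bpsd Yspd; rewrite mxtrace_mulC !mulmxA.
by apply: mxtrace_psd_mul => //; exact: psd_conj_sym.
Qed.

Lemma spd_quad_trace B X D : D^T = D -> spd X -> psd B ->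
  0 <= \tr (X *m D *m B *m D).
Proof.
move=> Ds Xspd Bpsd; rewrite -!mulmxA mxtrace_mulC.
by apply: mxtrace_psd_mul => //; rewrite mulmxA; exact: psd_conj_sym.
Qed.

Lemma psd_quad_trace_le B X Y D c : D^T = D -> psd (B - c *: X) -> spd Y ->
  c * \tr (X *m D *m Y *m D) <= \tr (B *m D *m Y *m D).
Proof.
move=> Ds BX /(psd_quad_trace Ds BX).
by rewrite !mulmxBl -!scalemxAl raddfB /= mxtraceZ subr_ge0.
Qed.

Lemma spd_quad_trace_le B X Y D c : D^T = D -> spd X -> psd (B - c *: Y) ->
  c * \tr (X *m D *m Y *m D) <= \tr (X *m D *m B *m D).
Proof.
move=> Ds Xspd /(spd_quad_trace Ds Xspd).
by rewrite mulmxBr mulmxBl -scalemxAr -scalemxAl raddfB /= mxtraceZ subr_ge0.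
Qed.

Lemma spd_of_ge (M : 'M[R]_n) (m : R) : 0 < m -> psd (M - m%:M) -> spd M.
Proof.
by move=> m0 /psd_spdD /(_ (spd_scalar n m0)); rewrite subrK.
Qed.

Lemma weighted_trace_ge X Y D (l : R) : 0 < l -> D^T = D ->
  spd Y -> psd (X - l^-1%:M) -> psd (Y - l^-1%:M) ->
  \tr (D^T *m D) <= l ^+ 2 * \tr (X *m D *m Y *m D).
Proof.
move=> l0 Ds Yspd; rewrite -scalemx1 => Xl Yl.
have h1 := psd_quad_trace_le Ds Xl Yspd.
have := spd_quad_trace_le Ds (spd_scalar n ltr01) Yl.
rewrite mulmx1 !mul1mx in h1 *; rewrite Ds => h2.
rewrite -ler_pdivrMl ?exprn_gt0 //; apply: le_trans h1.
by rewrite expr2 invfM -mulrA ler_pM2l ?invr_gt0.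
Qed.

Lemma weighted_trace_le X Y D (l : R) : 0 < l -> D^T = D ->
  spd Y -> psd (l^-1%:M - X) -> psd (l^-1%:M - Y) ->
  \tr (X *m D *m Y *m D) <= l ^- 2 * \tr (D^T *m D).
Proof.
move=> l0 Ds Yspd; rewrite -{1}[X]scale1r -{1}[Y]scale1r => Xl Yl.
have h1 := psd_quad_trace_le Ds Xl Yspd.
have := spd_quad_trace_le Ds (spd_scalar n ltr01) Yl.
move: h1; rewrite !mul1r !mul1mx mul_mx_scalar mul_scalar_mx -!scalemxAl.
rewrite !mxtraceZ Ds => h1 h2; apply: (le_trans h1).
by rewrite expr2 invfM -mulrA ler_pM2l ?invr_gt0.
Qed.

(** The derivative of [tr (X D Y D)] when
    [X' = - (X F1 + F1' X + G1)] and [Y' = - (Y F2 + F2' Y + G2)].  Writing the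
    derivative of the first [D] as [F1 D + D F2'] and that of the second one
    as [F2 D + D F1'], all drift terms cancel by cyclicity of the trace. *)
Lemma weighted_trace_cancel X Y D F1 F1' F2 F2' G1 G2 :
  F1 *m D + D *m F2' = F2 *m D + D *m F1' ->
  \tr ((((- (X *m F1 + F1' *m X + G1)) *m D + X *m (F1 *m D + D *m F2')) *m Y
     + X *m D *m (- (Y *m F2 + F2' *m Y + G2))) *m D
     + X *m D *m Y *m (F1 *m D + D *m F2')) =
  - (\tr (G1 *m D *m Y *m D) + \tr (X *m D *m G2 *m D)).
Proof.
move=> e; rewrite {2}e.
rewrite !(mulmxDl, mulmxDr, mulNmx, mulmxN, opprD, mulmxA).
rewrite !(mxtraceD, raddfN) /=.
have -> : \tr (F1' *m X *m D *m Y *m D) = \tr (X *m D *m Y *m D *m F1').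
  by rewrite [RHS]mxtrace_mulC !mulmxA.
ring.
Qed.

Variables (A S : R -> 'M[R]_n) (R1 : 'M[R]_n) (T r m l : R).
Hypotheses (r0 : 0 < r) (m0 : 0 < m) (l0 : 0 < l).
Hypothesis R1_ge : psd (R1 - r%:M).
Hypothesis S_psd : forall t, T <= t -> psd (S t).
Variables p q : R -> 'M[R]_n.
Hypothesis dp : forall t, riccati_path A S R1 T t p.
Hypothesis dq : forall t, riccati_path A S R1 T t q.
Hypothesis p_bounds : forall t, T <= t -> psd (p t - m%:M) /\ psd (l%:M - p t).
Hypothesis q_bounds : forall t, T <= t -> psd (q t - m%:M) /\ psd (l%:M - q t).

Lemma is_derive_precision t (x : R -> 'M[R]_n) : T <= t ->
  (forall t, riccati_path A S R1 T t x) -> x t \in unitmx ->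
  is_derive t (1 : R) (fun u => invmx (x u))
    (- (invmx (x t) *m drift A S x t + codrift A S x t *m invmx (x t) +
        (S t + invmx (x t) *m R1 *m invmx (x t)))).
Proof.
move=> Tt dx xu; have Ttt : T <= t <= t by rewrite Tt lexx.
apply: (is_derive_eq (is_derive_invmx xu (dx t t Ttt))); congr (- _).
rewrite /riccati_field /drift /codrift; set X := invmx _.
rewrite !(mulmxDl, mulmxDr, mulNmx, mulmxN, mulmxA).
rewrite mulVmx // mul1mx -!(mulmxA _ (x t) X) mulmxV // !mulmx1 mul1mx.
mxring.
Qed.

(** Multiplying [R1 >= r >= (r / l) x] on both sides by the inverse of [x]. *)
Lemma precision_source_ge t x : T <= t ->
  psd (x - m%:M) -> psd (l%:M - x) ->
  psd (S t + invmx x *m R1 *m invmx x - (r / l) *: invmx x).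
Proof.
move=> Tt xm xl; have xspd := spd_of_ge m0 xm; have xu := spd_unitmx xspd.
rewrite -addrA; apply: psdD; first exact: S_psd.
have -> : invmx x *m R1 *m invmx x - (r / l) *: invmx x =
    invmx x *m ((R1 - r%:M) + (r / l) *: (l%:M - x)) *m invmx x.
  rewrite !(mulmxDr, mulmxDl, mulmxN, mulNmx, mul_mx_scalar).
  rewrite -!(scalemxAr, scalemxAl) !(mulmxDr, mulmxDl, mulmxN, mulNmx).
  rewrite mulVmx // mul1mx mul_mx_scalar -!scalemxAl.
  apply/matrixP => i j; rewrite !(addmxE, oppmxE, scalemxE).
  by field; rewrite gt_eqF.
apply: psd_conj_sym; first by rewrite trmx_inv xspd.1.
by apply: psdD => //; apply: psdZ => //; rewrite divr_ge0 // ltW.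
Qed.

Lemma riccati_decay t : T <= t ->
  `|p t - q t| ^+ 2 <= l ^+ 2 * m ^- 2 * (n * n)%:R *
    expR (- (2 * (r / l)) * (t - T)) * `|p T - q T| ^+ 2.
Proof.
move=> Tt.
have pspd u : T <= u -> spd (p u) by move=> /p_bounds[/(spd_of_ge m0)].
have qspd u : T <= u -> spd (q u) by move=> /q_bounds[/(spd_of_ge m0)].
have Ds u : T <= u -> (p u - q u)^T = p u - q u.
  by move=> Tu; rewrite linearB /= (pspd _ Tu).1 (qspd _ Tu).1.
pose V u := \tr (invmx (p u) *m (p u - q u) *m invmx (q u) *m (p u - q u)).
pose W u := \tr ((S u + invmx (p u) *m R1 *m invmx (p u)) *m (p u - q u) *m
    invmx (q u) *m (p u - q u)) + \tr (invmx (p u) *m (p u - q u) *m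
    (S u + invmx (q u) *m R1 *m invmx (q u)) *m (p u - q u)).
have dV u : T <= u <= t -> is_derive u (1 : R) V (- W u).
  move=> /andP[Tu ut]; have Tuu : T <= u <= u by rewrite Tu lexx.
  have dX := is_derive_precision Tu dp (spd_unitmx (pspd u Tu)).
  have dY := is_derive_precision Tu dq (spd_unitmx (qspd u Tu)).
  have dD := riccati_pathB (@dp u) (@dq u) Tuu.
  apply: (is_derive_eq (is_derive_mxtrace (is_derive_mulmx (is_derive_mulmx
    (is_derive_mulmx dX dD) dY) dD))).
  by apply: weighted_trace_cancel; rewrite /drift /codrift; mxring.
have VW u : T <= u <= t -> - W u <= - (2 * (r / l)) * V u.
  move=> /andP[Tu ut].
  have [pm pl] := p_bounds Tu; have [qm ql] := q_bounds Tu.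
  have h1 := psd_quad_trace_le (Ds u Tu) (precision_source_ge Tu pm pl)
    (spd_invmx (qspd u Tu)).
  have h2 := spd_quad_trace_le (Ds u Tu) (spd_invmx (pspd u Tu))
    (precision_source_ge Tu qm ql).
  by move: h1 h2; rewrite -/(V u) /W; lra.
have := gronwall dV VW.
have Ttt : T <= t <= t by rewrite Tt lexx.
move=> /(_ t Ttt) Vt.
have [pm pl] := p_bounds Tt; have [qm ql] := q_bounds Tt.
have [pTm pTl] := p_bounds (lexx T); have [qTm qTl] := q_bounds (lexx T).
have low := weighted_trace_ge l0 (Ds t Tt) (spd_invmx (qspd t Tt))
  (psd_inv_ge l0 (pspd t Tt) pl) (psd_inv_ge l0 (qspd t Tt) ql).
have up := weighted_trace_le m0 (Ds T (lexx T)) (spd_invmx (qspd T (lexx T)))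
  (psd_inv_le m0 (pspd T (lexx T)) pTm) (psd_inv_le m0 (qspd T (lexx T)) qTm).
have frob := frobenius_le (p T - q T) (p T - q T).
apply: (le_trans (mx_norm_frobenius _)); apply: (le_trans low).
move: Vt; set e := expR _ => Vt; have e0 : 0 <= e by exact: expR_ge0.
have -> : l ^+ 2 * m ^- 2 * (n * n)%:R * e * `|p T - q T| ^+ 2 =
    l ^+ 2 * (e * (m ^- 2 * ((n * n)%:R * `|p T - q T| * `|p T - q T|))).
  by ring.
rewrite ler_wpM2l ?sqr_ge0 //; apply: (le_trans Vt); rewrite ler_wpM2l //.
by apply: (le_trans up); rewrite ler_wpM2l // invr_ge0 sqr_ge0.
Qed.

End Decay.

(** * Stability of the Riccati flow *)

Section Contraction.
Variables (R : realType) (r1 r2 : nat).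
Variables (A : R -> 'M[R]_r1) (C : R -> 'M[R]_(r2, r1)).
Variables (R1 : 'M[R]_r1) (R2 : 'M[R]_r2).
Hypotheses (A_bounded : [bounded A t | t in `[0, +oo[])
  (C_bounded : [bounded C t | t in `[0, +oo[])
  (R1_spd : spd R1) (R2_spd : spd R2).
Variable phi : R -> R -> 'M[R]_r1 -> 'M[R]_r1.
Hypothesis phi_riccati : riccati_flow A (Sflow C R2) R1 phi.

Lemma bounded_flowP m n (M : R -> 'M[R]_(m, n)) :
  [bounded M t | t in `[0, +oo[] -> exists k, forall t, 0 <= t -> `|M t| <= k.
Proof.
move=> [k [_ kP]]; exists (k + 1) => t t0.
by apply: (kP (k + 1)); rewrite ?ltrDl //= in_itv /= t0.
Qed.

Lemma Sflow_psd t : psd (Sflow C R2 t).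
Proof. exact/psd_conj/spd_psd/spd_invmx. Qed.

Lemma Sflow_bounded : exists k, forall t, 0 <= t -> `|Sflow C R2 t| <= k.
Proof.
have [k kP] := bounded_flowP C_bounded.
exists (r2%:R * (r2%:R * k * `|invmx R2|) * k) => t t0.
have Ck := kP t t0.
apply: mx_norm_mul_le => //; apply: mx_norm_mul_le => //.
exact: le_trans (mx_norm_trmx_le _) Ck.
Qed.

(** The solutions are continued to negative times, so that they are
    differentiable at time 0 in the ordinary sense. *)
Lemma riccati_flow_paths : exists psi : 'M[R]_r1 -> R -> 'M[R]_r1,
  forall Q, spd Q ->
    (forall t, 0 <= t -> psi Q t = phi 0 t Q) /\
    forall s T, 0 <= s -> riccati_path A (Sflow C R2) R1 s T (psi Q).
Proof.
suff /choice[psi psiP] : forall Q, exists p : R -> 'M[R]_r1, spd Q ->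
    (forall t, 0 <= t -> p t = phi 0 t Q) /\
    forall s T, 0 <= s -> riccati_path A (Sflow C R2) R1 s T p.
  by exists psi.
move=> Q; have [Qspd|] := pselect (spd Q); last by exists (fun=> 0).
have [_ dphi] := phi_riccati (lexx 0) Qspd.
have [p [pE dp]] := is_derive_within_extend dphi.
exists p => _; split=> // s T s0 t /andP[st _].
by rewrite pE ?(le_trans s0) //; apply: dp; exact: le_trans st.
Qed.

Variables (Lmin Lmax : 'M[R]_r1) (v : R).
Hypotheses (Lmin_spd : spd Lmin) (Lmax_spd : spd Lmax) (v0 : 0 < v).
Hypothesis phi_bounds : forall t Q, v <= t -> spd Q ->
  loewner_le Lmin (phi 0 t Q) /\ loewner_le (phi 0 t Q) Lmax.

(** The Lipschitz estimate carries the initial difference to time [v], and the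
    decay takes over from there. *)
Lemma riccati_uniform_contraction : exists K c : R, [/\ 0 <= K, 0 < c &
  forall t Q1 Q2, v <= t -> spd Q1 -> spd Q2 ->
  `|phi 0 t Q1 - phi 0 t Q2| <= K * expR (- c * (t - v)) * `|Q1 - Q2|].
Proof.
have [psi psiP] := riccati_flow_paths.
have [a aP] := bounded_flowP A_bounded; have [s sP] := Sflow_bounded.
have psiE t Q : 0 <= t -> spd Q -> psi Q t = phi 0 t Q.
  by move=> t0 /psiP[/(_ t t0)].
have dpsi Q t T : spd Q -> 0 <= t -> riccati_path A (Sflow C R2) R1 t T (psi Q).
  by move=> /psiP[_]; apply.
have [m m0 mLmin] := spd_ge_scalar Lmin_spd.
have [r r0 rR1] := spd_ge_scalar R1_spd.
pose l := r1%:R * `|Lmax| + 1; have l0 : 0 < l by rewrite ltr_wpDl // mulr_ge0.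
have lLmax : psd (l%:M - Lmax).
  by apply: psd_norm_sub; [exact: Lmax_spd.1 | rewrite /l lerDl].
have bounds Q : spd Q -> forall t, v <= t ->
    psd (psi Q t - m%:M) /\ psd (l%:M - psi Q t).
  move=> Qspd t vt; have [lo hi] := phi_bounds vt Qspd.
  rewrite psiE ?(le_trans (ltW v0)) //; split.
    by have := psdD lo mLmin; rewrite addrA subrK.
  by have := psdD lLmax hi; rewrite addrA subrK.
have psi_le Q : spd Q -> `|psi Q v| <= `|Lmax|.
  move=> Qspd; have [lo hi] := phi_bounds (lexx v) Qspd.
  rewrite (psiE _ _ (ltW v0) Qspd); apply: (psd_norm_le _ hi).
  by have := psdD lo (spd_psd Lmin_spd); rewrite subrK.
have [K K0 KP] : exists2 K : R, 0 <= K & forall Q1 Q2, spd Q1 -> spd Q2 ->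
    `|psi Q1 v - psi Q2 v| <= K * `|Q1 - Q2|.
  apply: (@riccati_flow_lipschitz R r1 A (Sflow C R2) R1 v (Num.max a s) `|Lmax|).
  - exact: ltW.
  - by move=> t /andP[t0 _]; rewrite le_max aP.
  - by move=> t /andP[t0 _]; rewrite le_max sP // orbT.
  - by move=> Q Qspd; rewrite psiE //; case: (phi_riccati (lexx 0) Qspd).
  - by move=> Q Qspd; exact: dpsi.
  - exact: psi_le.
pose L := Num.sqrt (l ^+ 2 * m ^- 2 * (r1 * r1)%:R).
exists (L * K), (r / l); split; first by rewrite mulr_ge0 ?sqrtr_ge0.
  by rewrite divr_gt0.
move=> t Q1 Q2 vt Q1spd Q2spd.
have t0 : 0 <= t by exact: le_trans (ltW v0) vt.
rewrite -!psiE //.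
have := riccati_decay r0 m0 l0 rR1 (fun t _ => Sflow_psd t)
  (fun T => dpsi Q1 v T Q1spd (ltW v0)) (fun T => dpsi Q2 v T Q2spd (ltW v0))
  (bounds Q1 Q1spd) (bounds Q2 Q2spd) vt.
set e := expR _; set D := `|psi Q1 v - _| => dec.
have -> : L * K * expR (- (r / l) * (t - v)) * `|Q1 - Q2| =
    L * expR (- (r / l) * (t - v)) * (K * `|Q1 - Q2|) by ring.
apply: (@le_trans _ _ (L * expR (- (r / l) * (t - v)) * D)); last first.
  by rewrite ler_wpM2l ?mulr_ge0 ?sqrtr_ge0 ?expR_ge0 // KP.
have D0 : 0 <= D by exact: normr_ge0.
rewrite -(ler_pXn2r (n := 2)) ?nnegrE ?mulr_ge0 ?sqrtr_ge0 ?expR_ge0 //.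
rewrite !exprMn sqr_sqrtr ?mulr_ge0 ?invr_ge0 ?sqr_ge0 ?(ltW l0) //.
rewrite -expRM_natl (_ : 2%:R * _ = - (2 * (r / l)) * (t - v)) //; ring.
Qed.

End Contraction.

Theorem theorem1p2 (R : realType) (r1 r2 : nat)
  (r1_ge1 : (1 <= r1)%N) (r2_ge1 : (1 <= r2)%N)
  (A : R -> 'M[R]_r1) (C : R -> 'M[R]_(r2, r1))
  (R1 : 'M[R]_r1) (R2 : 'M[R]_r2)
  (A_smooth : smooth_flow A) (C_smooth : smooth_flow C)
  (A_bounded : [bounded A t | t in `[0, +oo[])
  (C_bounded : [bounded C t | t in `[0, +oo[])
  (R1_spd : spd R1) (R2_spd : spd R2)
  (phi : R -> R -> 'M[R]_r1 -> 'M[R]_r1)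
  (phi_riccati : riccati_flow A (Sflow C R2) R1 phi)
  (E : R -> R -> 'M[R]_r1)
  (E_transition : transition_flow A E)
  (obs_ctrl : uniform_obs_ctrl E (Sflow C R2) R1) :
  exists (v : R) (alpha beta : 'M[R]_r1 -> 'M[R]_r1 -> R)
      (alphaQ : 'M[R]_r1 -> 'M[R]_r1 -> 'M[R]_r1 -> 'M[R]_r1 -> R),
    0 < v /\
    forall Lmin Lmax : 'M[R]_r1, riccati_bounds phi Lmin Lmax ->
      [/\ 0 < alpha Lmin Lmax,
          0 < beta Lmin Lmax,
          forall (t : R) (Q1 Q2 : 'M[R]_r1), v <= t -> spd Q1 -> spd Q2 ->
            specnorm (phi 0 t Q1 - phi 0 t Q2)
            <= alpha Lmin Lmax * expR (- beta Lmin Lmax * t)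
               * specnorm (Q1 - Q2)
        & forall Q1 Q2 : 'M[R]_r1, spd Q1 -> spd Q2 ->
            0 < alphaQ Lmin Lmax Q1 Q2 /\
            forall t : R, 0 <= t ->
              specnorm (phi 0 t Q1 - phi 0 t Q2)
              <= alphaQ Lmin Lmax Q1 Q2 * expR (- beta Lmin Lmax * t)
                 * specnorm (Q1 - Q2)].
Proof.
(* A single pair of bounds, if there is one, provides constants that serve for
   all pairs. *)
have [[[Lmin Lmax] /= [Lmin_spd Lmax_spd [v [v0 bnds]]]]|nobnds] := pselect
    (exists L : 'M[R]_r1 * 'M[R]_r1, riccati_bounds phi L.1 L.2); last first.
  exists 1, (fun _ _ => 1), (fun _ _ => 1), (fun _ _ _ _ => 1); split=> //.
  by move=> Lmin Lmax bL; case: nobnds; exists (Lmin, Lmax).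
have [K [c [K0 c0 KP]]] := riccati_uniform_contraction A_bounded C_bounded
  R1_spd R2_spd phi_riccati Lmin_spd Lmax_spd v0 bnds.
have [psi psiP] := riccati_flow_paths phi_riccati.
pose q : R := (r1 * r1)%:R; have q0 : 0 <= q by [].
pose al : R := q * K * expR (c * v) + 1.
have al0 : 0 < al by rewrite ltr_wpDl // !mulr_ge0 // expR_ge0.
have late t Q1 Q2 : v <= t -> spd Q1 -> spd Q2 ->
    specnorm (phi 0 t Q1 - phi 0 t Q2)
    <= al * expR (- c * t) * specnorm (Q1 - Q2).
  move=> vt Q1spd Q2spd; apply: (le_trans (specnorm_le _)).
  have Qge := specnorm_ge (Q1 - Q2).
  apply: (@le_trans _ _ (q * (K * expR (- c * (t - v)) * specnorm (Q1 - Q2)))).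
    rewrite ler_wpM2l // (le_trans (KP t Q1 Q2 vt Q1spd Q2spd)) //.
    by rewrite ler_wpM2l // mulr_ge0 // expR_ge0.
  have -> : - c * (t - v) = c * v + - c * t by ring.
  rewrite expRD !mulrA ler_wpM2r //; first exact: le_trans Qge.
  by rewrite ler_wpM2r ?expR_ge0 // lerDl.
have early Q1 Q2 : exists a : R, spd Q1 -> spd Q2 -> 0 < a /\
    forall t, 0 <= t -> specnorm (phi 0 t Q1 - phi 0 t Q2)
      <= a * expR (- c * t) * specnorm (Q1 - Q2).
  have [Q1spd|] := pselect (spd Q1); last by exists 0.
  have [Q2spd|] := pselect (spd Q2); last by exists 0.
  (* For equal initial values both sides vanish; otherwise the bound on the
     difference is divided by the norm of [Q1 - Q2]. *)
  have [->|Q12] := eqVneq Q1 Q2.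
    exists 1 => _ _; split=> // t t0; rewrite !subrr.
    apply: (le_trans (specnorm_le _)); rewrite normr0 mulr0.
    rewrite mul1r mulr_ge0 ?expR_ge0 //; apply: le_trans (specnorm_ge _).
    exact: normr_ge0.
  have Qge := specnorm_ge (Q1 - Q2).
  have Q0 : 0 < specnorm (Q1 - Q2).
    by apply: lt_le_trans Qge; rewrite normr_gt0 subr_eq0.
  have [e1 d1] := psiP Q1 Q1spd; have [e2 d2] := psiP Q2 Q2spd.
  have [k kP] := mx_bounded_segment (fun t t0v =>
    riccati_pathB (d1 0 v (lexx 0)) (d2 0 v (lexx 0)) t0v).
  have vv : 0 <= v <= v by rewrite lexx ltW.
  have k0 : 0 <= k := le_trans (normr_ge0 _) (kP v vv).
  pose a := q * k * expR (c * v) / specnorm (Q1 - Q2).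
  have a0 : 0 <= a by rewrite !mulr_ge0 ?invr_ge0 ?expR_ge0 // ltW.
  exists (al + a) => _ _; split=> [|t t0]; first by rewrite ltr_wpDr.
  have [vt|tv] := leP v t.
    apply: (le_trans (late t Q1 Q2 vt Q1spd Q2spd)).
    by rewrite (ler_wpM2r (ltW Q0)) // ler_wpM2r ?expR_ge0 // lerDl.
  apply: (le_trans (specnorm_le _)).
  apply: (@le_trans _ _ (a * expR (- c * t) * specnorm (Q1 - Q2))).
    have -> : a * expR (- c * t) * specnorm (Q1 - Q2) =
        q * k * (expR (c * v) * expR (- c * t)).
      by rewrite /a; field; rewrite gt_eqF.
    rewrite -expRD -/q -mulrA ler_wpM2l // -e1 // -e2 //.
    apply: (le_trans (kP t _)); first by rewrite t0 ltW.
    rewrite -[leLHS]mulr1 ler_wpM2l // -expR0 ler_expR mulNr subr_ge0.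
    by rewrite ler_pM2l // ltW.
  by rewrite (ler_wpM2r (ltW Q0)) // ler_wpM2r ?expR_ge0 // lerDr ltW.
have /choice[aQ aQP] : forall Q : 'M[R]_r1 * 'M[R]_r1, exists a : R,
    spd Q.1 -> spd Q.2 -> 0 < a /\
    forall t, 0 <= t -> specnorm (phi 0 t Q.1 - phi 0 t Q.2)
      <= a * expR (- c * t) * specnorm (Q.1 - Q.2).
  by move=> [Q1 Q2]; exact: early.
exists v, (fun _ _ => al), (fun _ _ => c), (fun _ _ Q1 Q2 => aQ (Q1, Q2)).
split=> // _ _ _; split=> // Q1 Q2 Q1spd Q2spd.
exact: (aQP (Q1, Q2)).
Qed.
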